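(* Let $f(x)$ be a divisibility polynomial. Then $f(x)=Cx^s g(x)$, where $C$ is a complex constant, $s\geq 0$ is an integer, and $g(x)$ is a (possibly empty) finite product of factors of the form $\Phi_{\langle n_1,\dots,n_k\rangle}(x^d)$, where for each factor $k\geq 1$, $d\geq 1$ and $n_i\geq 1$ are integers, $n_i\nmid n_j$ for $i\neq j$, and $\gcd(n_1,\dots,n_k)=1$.
   Context: $\mathbb{N}$ denotes the positive integers. A divisibility polynomial is a polynomial $f(x)$ with complex coefficients such that $f(x^m)\mid f(x^n)$ in $\mathbb{C}[x]$ whenever $m\mid n$ (equivalently, $f(x)\mid f(x^n)$ for all $n\in\mathbb{N}$). $\Phi_d(x)$ denotes the $d$-th cyclotomic polynomial. For $n_1,\dots,n_k\in\mathbb{N}$, $\langle n_1,\dots,n_k\rangle:=\{d\in\mathbb{N} : d\mid n_i \text{ for some } i\}$, and for a finite set $\Lambda\subset\mathbb{N}$, $\Phi_\Lambda(x):=\prod_{d\in\Lambda}\Phi_d(x)$; in particular $\Phi_{\langle n_1,\dots,n_k\rangle}(x)=\prod_{d\in\langle n_1,\dots,n_k\rangle}\Phi_d(x)$. *)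

(* Defs.v *)
From HB Require Import structures.
From mathcomp Require Import all_boot all_order all_algebra.
From mathcomp Require Import cyclotomic finmap complex reals.

Set Implicit Arguments.
Unset Strict Implicit.
Unset Printing Implicit Defensive.

Import GRing.Theory.
Local Open Scope ring_scope.

Definition divisibility_poly (F : fieldType) (f : {poly F}) : Prop :=
  forall m n : nat, (0 < m)%N -> (0 < n)%N -> (m %| n)%N ->
    f \Po 'X^m %| f \Po 'X^n.

(* <n_1, ..., n_k>, the set of all positive divisors of the n_i; only meaningful
   when all n_i > 0, since the list divisors 0 is [:: 1]. *)
Definition divisor_closure (ns : seq nat) : {fset nat} :=
  [fset d in flatten [seq divisors n | n <- ns]]%fset.

Lemma in_divisor_closure (ns : seq nat) (d : nat) :
  all (leq 1) ns ->
  (d \in divisor_closure ns) = has (fun n => d %| n)%N ns.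
Proof.
move=> /allP ns_gt0; rewrite /divisor_closure in_fset /=.
apply/flattenP/hasP => [[s /mapP[n n_in ->]] | [n n_in d_n]].
  by rewrite -dvdn_divisors ?ns_gt0 // => d_n; exists n.
by exists (divisors n); [apply: map_f | rewrite -dvdn_divisors ?ns_gt0].
Qed.

(* The integral cyclotomic polynomials are mapped into F; L is meant to contain
   positive integers only ('Phi_0 is a junk value). *)
Definition Phi_set (F : fieldType) (L : {fset nat}) : {poly F} :=
  \prod_(d <- L) map_poly intr 'Phi_d.

Definition antichain_dvd (ns : seq nat) : Prop :=
  forall i j : nat, (i < size ns)%N -> (j < size ns)%N -> i <> j ->
    ~~ (nth 0%N ns i %| nth 0%N ns j)%N.

(* h(x) = Phi_<n_1, ..., n_k>(x^d), with ns = [:: n_1; ...; n_k]. *)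
Definition basic_factor (F : fieldType) (h : {poly F}) : Prop :=
  exists (ns : seq nat) (d : nat),
    [/\ (1 <= size ns)%N,
        (1 <= d)%N,
        (forall n, n \in ns -> (1 <= n)%N),
        antichain_dvd ns /\ \big[gcdn/0%N]_(n <- ns) n = 1%N
      & h = Phi_set F (divisor_closure ns) \Po 'X^d].

(* Main.v *)
(** For x != 0 the multiplicity of x in f(x^n) is that of x^n in f, so f | f(x^n)
    says that the multiplicity does not decrease along x |-> x^n. In particular
    the nonzero roots of f are closed under powers; being finitely many, they are
    roots of unity, and they are exactly the solutions of x^(n_i) = 1 for some i,
    where n_1, ..., n_k are the orders maximal for divisibility. With g the gcd of
    the n_i, these are the roots of Phi_<n_1/g, ..., n_k/g>(x^g), all simple.
    Dividing f by this factor lowers by one every positive multiplicity at a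
    nonzero point, so the quotient satisfies the same monotonicity condition. *)

Require Import Defs.
From HB Require Import structures.
From mathcomp Require Import all_boot all_order all_algebra.
From mathcomp Require Import cyclotomic finmap complex reals.
From mathcomp Require Import separable.

Import GRing.Theory.
Local Open Scope ring_scope.
Local Open Scope complex_scope.

(** * Divisibility antichains and gcds of lists of integers *)

Lemma exists_dvd_antichain (os : seq nat) :
  exists ns : seq nat,
    [/\ antichain_dvd ns,
        {subset ns <= os}
      & forall o, o \in os -> exists2 n, n \in ns & (o %| n)%N].
Proof.
(* [pairwise] only looks at positions i < j, so [incomp] excludes divisibility in both directions;
   this also rules out repetitions. *)
pose incomp (m n : nat) := ~~ (m %| n)%N && ~~ (n %| m)%N.
suff [ns [ns_incomp ns_sub ns_dom]] : exists ns : seq nat,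
    [/\ pairwise incomp ns, {subset ns <= os}
      & forall o, o \in os -> exists2 n, n \in ns & (o %| n)%N].
  exists ns; split=> // i j i_lt j_lt /eqP.
  have /(pairwiseP 0%N) incompP := ns_incomp.
  rewrite neq_ltn => /orP[ij | ji].
    by have /andP[] := incompP i j i_lt j_lt ij.
  by have /andP[] := incompP j i j_lt i_lt ji.
elim: os => [|o os [ns [ns_incomp ns_sub ns_dom]]]; first by exists [::].
have [/hasP[n n_in o_n] | /hasPn no_dvd] := boolP (has (dvdn o) ns).
  exists ns; split=> // [m /ns_sub m_in | m].
    by rewrite inE m_in orbT.
  by rewrite inE => /predU1P[-> | /ns_dom //]; exists n.
(* As [o] divides no kept element, it is added and its divisors are dropped; whatever they
   dominated, [o] dominates by transitivity. *)
exists (o :: [seq n <- ns | ~~ (n %| o)%N]); split=> [|m|m].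
- rewrite pairwise_cons pairwise_filter // andbT; apply/allP=> m.
  by rewrite mem_filter /incomp => /andP[-> /no_dvd ->].
- rewrite !inE mem_filter => /predU1P[-> | /andP[_ /ns_sub ->]].
    by rewrite eqxx.
  by rewrite orbT.
- rewrite inE => /predU1P[-> | /ns_dom[n n_in m_n]].
    by exists o; rewrite ?mem_head.
  have [n_o | n_o] := boolP (n %| o)%N.
    by exists o; rewrite ?mem_head // (dvdn_trans m_n).
  by exists n; rewrite // inE mem_filter n_o n_in orbT.
Qed.

Lemma factor_biggcdn (ns : seq nat) :
  (0 < size ns)%N -> all (leq 1) ns ->
  exists (g : nat) (ms : seq nat),
    [/\ (0 < g)%N, \big[gcdn/0%N]_(m <- ms) m = 1%N & ns = map (muln g) ms].
Proof.
move=> ns_nil /allP ns_gt0; set g := \big[gcdn/0%N]_(n <- ns) n.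
have g_dvd n : n \in ns -> (g %| n)%N.
  by move=> n_in; rewrite /g (big_rem n) //= dvdn_gcdl.
have g_gt0 : (0 < g)%N.
  have n_in := mem_nth 0%N ns_nil.
  exact: dvdn_gt0 (ns_gt0 _ n_in) (g_dvd _ n_in).
have nsE : ns = map (muln g) [seq n %/ g | n <- ns]%N.
  rewrite -map_comp -[LHS]map_id; apply/eq_in_map => n n_in /=.
  by rewrite mulnC divnK ?g_dvd.
exists g, [seq n %/ g | n <- ns]%N; split=> //.
(* Multiplication by [g] commutes with gcds, so [g] times the gcd of the quotients is [g] again. *)
apply/eqP; rewrite -(eqn_pmul2l g_gt0) muln1.
rewrite (big_morph (muln g) (muln_gcdr g) (muln0 g)).
by rewrite -(big_map (muln g) xpredT id) -nsE.
Qed.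

Lemma antichain_dvd_map_muln (g : nat) (ms : seq nat) :
  (0 < g)%N -> antichain_dvd (map (muln g) ms) -> antichain_dvd ms.
Proof.
move=> g_gt0 anti i j i_lt j_lt ij.
have := anti i j; rewrite size_map !(nth_map 0%N) //.
by rewrite dvdn_pmul2l //; apply.
Qed.

(** * Multiplicities of roots in characteristic zero *)

Section Multiplicity.
Variable F : fieldType.
Hypothesis charF0 : [pchar F] =i pred0.

Lemma natr_neq0 (n : nat) : (0 < n)%N -> n%:R != 0 :> F.
Proof. by move/pcharf0P: charF0 => ->; rewrite -lt0n. Qed.

Lemma separable_Xn_sub_1_pchar0 (n : nat) :
  (0 < n)%N -> separable_poly ('X^n - 1 : {poly F}).
Proof. by move=> n_gt0; apply/separable_Xn_sub_1/natr_neq0. Qed.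

(** In characteristic 0 a nonzero x is a simple root of X^n - x^n, so substituting X^n turns each
    factor X - x^n of f into exactly one factor X - x, up to a cofactor nonzero at x. *)
Lemma mup_comp_Xn (f : {poly F}) (x : F) (n : nat) :
  f != 0 -> x != 0 -> (0 < n)%N -> mup x (f \Po 'X^n) = mup (x ^+ n) f.
Proof.
move=> f_neq0 x_neq0 n_gt0.
have [k [q]] := multiplicity_XsubC f (x ^+ n); rewrite f_neq0 /= => q_root ->.
have [r rE] : exists r, 'X^n - (x ^+ n)%:P = r * ('X - x%:P).
  by apply/factor_theorem; rewrite /root !hornerE subrr.
have r_root : ~~ root r x.
  (* Differentiating [rE] and evaluating at x gives r(x) = n x^(n-1). *)
  have /(congr1 (fun p => p^`().[x])) := rE.
  rewrite derivB derivC derivXn derivM derivXsubC !hornerE /= subrr mulr0 add0r.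
  rewrite hornerMn hornerXn => rx.
  by rewrite /root -rx subr0 -mulr_natr mulf_neq0 ?expf_neq0 ?natr_neq0.
rewrite comp_polyM rmorphXn /= comp_polyB comp_polyX comp_polyC rE exprMn mulrA.
rewrite !mupMr ?mup_XsubCX ?eqxx //.
by rewrite rootM root_comp hornerXn negb_or q_root /root horner_exp expf_neq0.
Qed.

Lemma mup_separable (p : {poly F}) (x : F) :
  separable_poly p -> mup x p = root p x.
Proof.
move=> p_sep; have p_neq0 := separable_poly_neq0 p_sep.
have [p_root | /mupNroot //] := boolP (root p x).
apply/eqP; rewrite eqn_leq -XsubC_dvd // dvdp_XsubCl p_root andbT.
by rewrite mup_leq // (separable_nosquare p_sep) ?size_XsubC.
Qed.

End Multiplicity.

(** * Products of cyclotomic polynomials over a field *)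

Section CyclotomicProducts.
Variable F : fieldType.

Lemma prod_Cyclotomic_field (n : nat) : (0 < n)%N ->
  \prod_(d <- divisors n) map_poly intr 'Phi_d = 'X^n - 1 :> {poly F}.
Proof.
move=> n_gt0; rewrite -rmorph_prod /= prod_Cyclotomic //.
by rewrite rmorphB /= map_polyXn rmorph1.
Qed.

Lemma Phi_set_dvd (L : {fset nat}) (n : nat) :
  (0 < n)%N -> (forall d, d \in L -> (d %| n)%N) ->
  Phi_set F L %| 'X^n - 1.
Proof.
move=> n_gt0 L_dvd; rewrite -prod_Cyclotomic_field // (bigID (mem L)) /=.
rewrite -big_filter; apply: dvdp_mulr; rewrite /Phi_set.
rewrite (perm_big [seq d <- divisors n | d \in L]) //=.
apply: uniq_perm; rewrite ?filter_uniq ?divisors_uniq ?fset_uniq // => d.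
rewrite mem_filter -dvdn_divisors //.
by have [/L_dvd -> |] := boolP (d \in L).
Qed.

(** The identity X^m - 1 = prod_(d | m) Phi_d, used for each m in [ms], suffices; the roots of a
    single Phi_d need not be identified. *)
Lemma root_Phi_set_divisor_closure (ms : seq nat) (x : F) :
  all (leq 1) ms ->
  root (Phi_set F (divisor_closure ms)) x = has (fun m => x ^+ m == 1) ms.
Proof.
move=> ms_gt0.
have rootXn m : (x ^+ m == 1) = root ('X^m - 1) x.
  by rewrite /root !hornerE subr_eq0.
have root_prod (ds : seq nat) :
    root (\prod_(d <- ds) map_poly intr 'Phi_d) x
    = has (fun d => root (map_poly intr 'Phi_d) x) ds.
  by apply: negb_inj; rewrite -(big_map _ xpredT id) root_bigmul all_map -all_predC.
rewrite root_prod; apply/hasP/hasP => [[d] | [m m_in]].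
  rewrite in_divisor_closure // => /hasP[m m_in d_m] d_root.
  exists m => //; have m_gt0 := allP ms_gt0 m m_in.
  rewrite rootXn -prod_Cyclotomic_field // root_prod; apply/hasP.
  by exists d; rewrite // -dvdn_divisors.
have m_gt0 := allP ms_gt0 m m_in.
rewrite rootXn -prod_Cyclotomic_field // root_prod => /hasP[d].
rewrite -dvdn_divisors // => d_m d_root; exists d => //.
by rewrite in_divisor_closure //; apply/hasP; exists m.
Qed.

(** With [n] a common multiple of [ms], the polynomial divides X^(g n) - 1, which is separable in
    characteristic 0. *)
Lemma separable_Phi_comp_Xn (ms : seq nat) (g : nat) :
  [pchar F] =i pred0 -> all (leq 1) ms -> (0 < g)%N ->
  separable_poly (Phi_set F (divisor_closure ms) \Po 'X^g).
Proof.
move=> charF0 ms_gt0 g_gt0; set n := (\prod_(m <- ms) m)%N.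
have n_gt0 : (0 < n)%N by rewrite /n big_seq prodn_cond_gt0 // => m /(allP ms_gt0).
have dvd_n : Phi_set F (divisor_closure ms) %| 'X^n - 1.
  apply: Phi_set_dvd => // d; rewrite in_divisor_closure // => /hasP[m m_in].
  by move/dvdn_trans; apply; rewrite /n (big_rem m) //= dvdn_mulr.
apply: dvdp_separable (separable_Xn_sub_1_pchar0 F charF0 (g * n) _).
  have := dvdp_comp_poly 'X^g dvd_n.
  by rewrite comp_polyB comp_Xn_poly -exprM -[1]polyC1 comp_polyC.
by rewrite muln_gt0 g_gt0.
Qed.

End CyclotomicProducts.

(** * Roots of unity and the extraction of basic factors *)

Lemma root_of_unity_of_power_closed (F : fieldType) (f : {poly F}) (x : F) :
  f != 0 -> x != 0 -> (forall n, (0 < n)%N -> root f (x ^+ n)) ->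
  exists2 n, (0 < n < size f)%N & n.-primitive_root x.
Proof.
move=> f_neq0 x_neq0 f_root.
(* These [size f] powers are all roots, one more than the degree allows, so two of them coincide. *)
have : ~~ uniq [seq x ^+ i.+1 | i <- iota 0 (size f)].
  apply/negP=> /(max_poly_roots f_neq0); rewrite size_map size_iota ltnn.
  move=> not_all; suff: false by []; apply: not_all.
  by apply/allP=> _ /mapP[i _ ->]; exact: f_root.
case/(uniqPn 0)=> i [j []]; rewrite size_map size_iota => ij j_lt.
have i_lt := ltn_trans ij j_lt.
rewrite !(nth_map 0%N) ?size_iota // !nth_iota // !add0n => xij.
have x1 : x ^+ (j - i) = 1.
  apply: (mulIf (expf_neq0 i.+1 x_neq0)).
  by rewrite -exprD addnS subnK ?mul1r -?xij // ltnW.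
have ji_gt0 : (0 < j - i)%N by rewrite subn_gt0.
have [n x_prim n_dvd] := prim_order_exists ji_gt0 x1; exists n => //.
rewrite (prim_order_gt0 x_prim) /=.
exact: leq_ltn_trans (dvdn_leq ji_gt0 n_dvd) (leq_ltn_trans (leq_subr _ _) j_lt).
Qed.

Section Decomposition.
Variable F : closedFieldType.
Hypothesis charF0 : [pchar F] =i pred0.

Lemma exists_basic_factor (f : {poly F}) (x0 : F) :
  f != 0 -> (forall x n, (0 < n)%N -> root f x -> root f (x ^+ n)) ->
  root f x0 -> x0 != 0 ->
  exists h : {poly F},
    [/\ basic_factor h, separable_poly h
      & forall x, root h x = (x != 0) && root f x].
Proof.
move=> f_neq0 f_root x0_root x0_neq0.
have [rs fE] := closed_field_poly_normal f.
have rootE x : root f x = (x \in rs).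
  by rewrite fE rootZ ?lead_coef_eq0 // root_prod_XsubC.
(* The orders of the nonzero roots; they are all below [size f], so a bounded search finds them. *)
pose os := [seq n <- iota 1 (size f) | has n.-primitive_root rs].
have order_in x : x != 0 -> root f x -> exists2 n, n \in os & n.-primitive_root x.
  move=> x_neq0 x_root.
  have [n n_gt0 | n /andP[n_gt0 n_lt] x_prim] :=
    @root_of_unity_of_power_closed F f x f_neq0 x_neq0; first exact: f_root.
  exists n => //; rewrite mem_filter mem_iota n_gt0 /= add1n ltnS ltnW // andbT.
  by apply/hasP; exists x; rewrite -?rootE.
have [ns [ns_anti ns_sub ns_dom]] := exists_dvd_antichain os.
have ns_gt0 : all (leq 1) ns.
  by apply/allP=> n /ns_sub; rewrite mem_filter mem_iota => /and3P[].
have ns_nil : (0 < size ns)%N.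
  have [o /ns_dom[n n_in _] _] := order_in _ x0_neq0 x0_root.
  by case: (ns) n_in.
have [g [ms [g_gt0 ms_gcd nsE]]] := factor_biggcdn ns ns_nil ns_gt0.
have ms_gt0 : all (leq 1) ms.
  apply/allP=> m m_in; have /(allP ns_gt0) : (g * m)%N \in ns.
    by rewrite nsE map_f.
  by rewrite muln_gt0 => /andP[].
exists (Phi_set F (divisor_closure ms) \Po 'X^g); split.
- exists ms, g; split=> //; first by rewrite -(size_map (muln g)) -nsE.
    exact/allP.
  by split=> //; apply: (@antichain_dvd_map_muln g); rewrite -?nsE.
- exact: separable_Phi_comp_Xn.
move=> x; rewrite root_comp hornerXn root_Phi_set_divisor_closure //.
have -> : has (fun m => (x ^+ g) ^+ m == 1) ms = has (fun n => x ^+ n == 1) ns.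
  by rewrite nsE has_map; apply: eq_has => m /=; rewrite exprM.
apply/hasP/andP => [[n n_in /eqP xn] | [x_neq0 x_root]].
  have n_gt0 := allP ns_gt0 n n_in; split.
    apply: contra_eq_neq xn => ->; rewrite expr0n gtn_eqF //= eq_sym.
    exact: oner_neq0.
  (* Here n is the order of some root r, so x is a power r^k. As k may be 0 and [f_root] needs a
     positive exponent, r^(n + k) is used instead. *)
  have := ns_sub n n_in; rewrite mem_filter => /andP[/hasP[r r_in r_prim] _].
  have [k ->] := prim_rootP r_prim xn.
  rewrite -[r ^+ k]mul1r -(prim_expr_order r_prim) -exprD.
  by apply: f_root; rewrite ?rootE // addn_gt0 n_gt0.
have [o /ns_dom[n n_in o_n] x_prim] := order_in x x_neq0 x_root.
by exists n => //; rewrite -(prim_order_dvd x_prim).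
Qed.

(** Induction on the size. The hypothesis is on multiplicities because closure of the root set under
    powers need not pass to the quotient: (X + 1)^2 (X - 1) divided by X^2 - 1 leaves X + 1. *)
Lemma basic_factorization (f : {poly F}) :
  f != 0 ->
  (forall x n, x != 0 -> (0 < n)%N -> (mup x f <= mup (x ^+ n) f)%N) ->
  exists (C : F) (s : nat) (hs : seq {poly F}),
    (forall h, h \in hs -> basic_factor h) /\
    f = C%:P * 'X^s * \prod_(h <- hs) h.
Proof.
have [n] := ubnP (size f); elim: n => // n IH in f *.
rewrite ltnS => f_size f_neq0 f_mup.
have rootE x : root f x = (0 < mup x f)%N by rewrite -XsubC_dvd // dvdp_XsubCl.
have f_root x k : (0 < k)%N -> root f x -> root f (x ^+ k).
  move=> k_gt0; have [-> | x_neq0] := eqVneq x 0; first by rewrite expr0n gtn_eqF.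
  rewrite !rootE => x_root; exact: leq_trans x_root (f_mup x k x_neq0 k_gt0).
have [rs fE] := closed_field_poly_normal f.
have lead_f : lead_coef f != 0 by rewrite lead_coef_eq0.
have [/hasP[x0 x0_in x0_neq0] | /hasPn rs0] :=
  boolP (has (fun x => x != 0) rs); last first.
  (* With 0 as the only possible root, f is a monomial. *)
  exists (lead_coef f), (size rs), [::]; split=> //.
  rewrite big_nil mulr1 [LHS]fE -mul_polyC; congr (_ * _).
  rewrite big_seq (eq_bigr (fun=> 'X)) => [|x /rs0]; last first.
    by rewrite negbK => /eqP ->; rewrite subr0.
  by rewrite -big_seq big_const_seq count_predT -Monoid.iteropE.
have x0_root : root f x0 by rewrite fE rootZ // root_prod_XsubC.
have [h [h_basic h_sep h_root]] :=
  exists_basic_factor _ _ f_neq0 f_root x0_root x0_neq0.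
have h_neq0 := separable_poly_neq0 h_sep.
(* The roots of [h] are simple and are roots of f. *)
have /dvdpP[q fq] : h %| f.
  have [ts hE] := closed_field_poly_normal h.
  have lead_h : lead_coef h != 0 by rewrite lead_coef_eq0.
  rewrite hE dvdpZl // uniq_roots_dvdp ?uniq_rootsE //.
    apply/allP=> t t_in; suff: root h t by rewrite h_root => /andP[].
    by rewrite hE rootZ // root_prod_XsubC.
  move: h_sep; rewrite -separable_prod_XsubC hE.
  by rewrite (eqp_separable (eqp_scale _ lead_h)).
have q_neq0 : q != 0 by apply: contraNneq f_neq0 => q0; rewrite fq q0 mul0r.
have mupE x : mup x f = (mup x q + root h x)%N.
  by rewrite fq mupM // (mup_separable _ h).
have q_size : (size q < n)%N.
  apply: leq_trans f_size; rewrite fq size_mul // -subn1 -addnBA ?size_poly_gt0 //.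
  have : (1 < size h)%N by apply: (@root_size_gt1 _ x0); rewrite // h_root x0_neq0.
  by case: (size h) => [|[|k]] // _; rewrite subn1 addnS ltnS leq_addr.
have q_mup x k : x != 0 -> (0 < k)%N -> (mup x q <= mup (x ^+ k) q)%N.
  move=> x_neq0 k_gt0; have := f_mup x k x_neq0 k_gt0.
  rewrite (mupE x) (mupE (x ^+ k)) !h_root x_neq0 (expf_neq0 k x_neq0) /=.
  (* If x is a root of f, so is x^k, and both multiplicities drop by one; otherwise that of x in [q]
     is already 0. *)
  have [x_root | x_root] := boolP (root f x).
    by rewrite (f_root x k k_gt0 x_root) leq_add2r.
  by have /eqP := mupNroot x_root; rewrite mupE addn_eq0 => /andP[/eqP -> _].
have [C [s [hs [hs_basic qE]]]] := IH q q_size q_neq0 q_mup.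
exists C, s, (h :: hs); split=> [h' | ].
  by rewrite inE => /predU1P[-> // | /hs_basic].
by rewrite big_cons fq qE mulrCA mulrC mulrA.
Qed.

End Decomposition.

Theorem theorem4 (R : realType) (f : {poly R[i]}) (hf : divisibility_poly f) :
  exists (C : R[i]) (s : nat) (hs : seq {poly R[i]}),
    (forall h, h \in hs -> basic_factor h) /\
    f = C%:P * 'X^s * \prod_(h <- hs) h.
Proof.
have charC0 : [pchar R[i]] =i pred0 by exact: Num.Theory.pchar_num.
have [-> | f_neq0] := eqVneq f 0.
  by exists 0, 0%N, [::]; rewrite polyC0 !mul0r.
apply: (basic_factorization _ charC0 f f_neq0) => x n x_neq0 n_gt0.
(* The case m = 1 gives f | f(X^n); comparing multiplicities at x yields the required inequality. *)
have := hf 1%N n isT n_gt0 (dvd1n n); rewrite expr1 comp_polyXr => f_dvd.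
have fn_neq0 : f \Po 'X^n != 0.
  by rewrite comp_poly_eq0 // size_polyXn ltnS.
rewrite -mup_comp_Xn // mup_geq //.
by apply: dvdp_trans f_dvd; rewrite -mup_geq.
Qed.
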